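(* Let $k$ be an algebraically closed field of characteristic zero. In any fusion category over $k$, the identity functor is isomorphic to the functor ${*}{*}{*}{*}: V\mapsto V^{****}$ as a tensor functor.
   Context: A fusion category over $k$ is a $k$-linear semisimple rigid tensor (= monoidal) category with finitely many isomorphism classes of simple objects, finite dimensional spaces of morphisms, and $\operatorname{End}(\mathbf 1)=k$, where $\mathbf 1$ is the unit object. $V\mapsto V^*$ denotes the duality; the double dual $V\mapsto V^{**}$, and hence $V\mapsto V^{****}$, is a tensor functor via the canonical isomorphisms $(V\otimes W)^{*}\cong W^{*}\otimes V^{*}$. An isomorphism of tensor functors is a natural isomorphism compatible with the tensor structures (a monoidal natural isomorphism). *)

(* Defs.v *)
From HB Require Import structures.
From mathcomp Require Import all_boot all_order all_algebra.

Set Implicit Arguments.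
Unset Strict Implicit.
Unset Printing Implicit Defensive.

Import GRing.Theory.
Local Open Scope ring_scope.

Declare Scope cat_scope.
Delimit Scope cat_scope with cat.
Local Open Scope cat_scope.

Reserved Notation "f >>> g" (at level 50, left associativity).
Reserved Notation "X ⊗ Y" (at level 40, left associativity).
Reserved Notation "f ⊠ g" (at level 40, left associativity).

(** * Linear categories *)

(* A [vectType] is a finite-dimensional vector space, so finite-dimensionality
   of the morphism spaces is part of this structure.  Composition is written
   in diagrammatic order: [f >>> g] is "f, then g". *)
Record linear_category (k : fieldType) := LinearCategory {
  obj :> Type;
  hom : obj -> obj -> vectType k;
  idm : forall X, hom X X;
  comp : forall X Y Z, hom X Y -> hom Y Z -> hom X Z;
  comp_idl : forall X Y (f : hom X Y), comp (idm X) f = f;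
  comp_idr : forall X Y (f : hom X Y), comp f (idm Y) = f;
  comp_assoc : forall X Y Z T (f : hom X Y) (g : hom Y Z) (h : hom Z T),
    comp f (comp g h) = comp (comp f g) h;
  comp_linearl : forall X Y Z (g : hom Y Z), linear (fun f : hom X Y => comp f g);
  comp_linearr : forall X Y Z (f : hom X Y), linear (fun g : hom Y Z => comp f g)
}.

Arguments hom {k l} X Y.
Arguments idm {k l} X.
Arguments comp {k l X Y Z} f g.

Notation "f >>> g" := (comp f g) : cat_scope.

Section LinearCategoryTheory.
Variables (k : fieldType) (C : linear_category k).
Implicit Types X Y Z : C.

Definition is_iso X Y (f : hom X Y) : Prop :=
  exists g : hom Y X, f >>> g = idm X /\ g >>> f = idm Y.

Definition isomorphic X Y : Prop := exists f : hom X Y, is_iso f.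

(* Hom-spaces always contain 0, so "exactly one morphism" means "only 0". *)
Definition is_zero_obj X : Prop :=
  (forall Y (f : hom X Y), f = 0) /\ (forall Y (f : hom Y X), f = 0).

Definition mono X Y (f : hom X Y) : Prop :=
  forall Z (g h : hom Z X), g >>> f = h >>> f -> g = h.

Definition epi X Y (f : hom X Y) : Prop :=
  forall Z (g h : hom Y Z), f >>> g = f >>> h -> g = h.

Definition is_kernel X Y (f : hom X Y) K (i : hom K X) : Prop :=
  i >>> f = 0 /\
  forall Z (g : hom Z X), g >>> f = 0 -> exists! h : hom Z K, h >>> i = g.

Definition is_cokernel X Y (f : hom X Y) Q (p : hom Y Q) : Prop :=
  f >>> p = 0 /\
  forall Z (g : hom Y Z), f >>> g = 0 -> exists! h : hom Q Z, p >>> h = g.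

Definition is_direct_sum n (S : 'I_n -> C) X : Prop :=
  exists (i : forall j, hom (S j) X) (p : forall j, hom X (S j)),
  [/\ forall j, i j >>> p j = idm (S j),
      forall j l, j != l -> i j >>> p l = 0
    & \sum_(j < n) (p j >>> i j) = idm X].

(* The case n = 0 provides a zero object. *)
Definition has_finite_direct_sums : Prop :=
  forall n (S : 'I_n -> C), exists X, is_direct_sum S X.

Definition abelian_category : Prop :=
  [/\ has_finite_direct_sums,
      forall X Y (f : hom X Y), exists K (i : hom K X), is_kernel f i,
      forall X Y (f : hom X Y), exists Q (p : hom Y Q), is_cokernel f p,
      forall X Y (f : hom X Y), mono f ->
        exists Z (g : hom Y Z), is_kernel g f
    & forall X Y (f : hom X Y), epi f ->
        exists Z (g : hom Z X), is_cokernel g f].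

Definition simple_obj X : Prop :=
  ~ is_zero_obj X /\
  forall Y (f : hom Y X), mono f -> is_zero_obj Y \/ is_iso f.

Definition semisimple_category : Prop :=
  abelian_category /\
  forall X, exists n (S : 'I_n -> C),
    (forall j, simple_obj (S j)) /\ is_direct_sum S X.

Definition finitely_many_simples : Prop :=
  exists n (S : 'I_n -> C), forall X, simple_obj X -> exists j, isomorphic X (S j).

End LinearCategoryTheory.

(** * Monoidal and rigid categories *)

Record monoidal_category (k : fieldType) := MonoidalCategory {
  mon_cat :> linear_category k;
  tens : mon_cat -> mon_cat -> mon_cat;
  tensm : forall X X' Y Y' : mon_cat,
    hom X X' -> hom Y Y' -> hom (tens X Y) (tens X' Y');
  unit_obj : mon_cat;
  assoc : forall X Y Z : mon_cat, hom (tens (tens X Y) Z) (tens X (tens Y Z));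
  assocV : forall X Y Z : mon_cat, hom (tens X (tens Y Z)) (tens (tens X Y) Z);
  lunit : forall X : mon_cat, hom (tens unit_obj X) X;
  lunitV : forall X : mon_cat, hom X (tens unit_obj X);
  runit : forall X : mon_cat, hom (tens X unit_obj) X;
  runitV : forall X : mon_cat, hom X (tens X unit_obj);
  tensm_id : forall X Y : mon_cat, tensm (idm X) (idm Y) = idm (tens X Y);
  tensm_comp : forall (X X' X'' Y Y' Y'' : mon_cat)
      (f : hom X X') (f' : hom X' X'') (g : hom Y Y') (g' : hom Y' Y''),
    tensm (f >>> f') (g >>> g') = tensm f g >>> tensm f' g';
  tensm_linearl : forall (X X' Y Y' : mon_cat) (g : hom Y Y'),
    linear (fun f : hom X X' => tensm f g);
  tensm_linearr : forall (X X' Y Y' : mon_cat) (f : hom X X'),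
    linear (fun g : hom Y Y' => tensm f g);
  assocK : forall X Y Z, assoc X Y Z >>> assocV X Y Z = idm _;
  assocVK : forall X Y Z, assocV X Y Z >>> assoc X Y Z = idm _;
  lunitK : forall X, lunit X >>> lunitV X = idm _;
  lunitVK : forall X, lunitV X >>> lunit X = idm _;
  runitK : forall X, runit X >>> runitV X = idm _;
  runitVK : forall X, runitV X >>> runit X = idm _;
  assoc_nat : forall (X X' Y Y' Z Z' : mon_cat)
      (f : hom X X') (g : hom Y Y') (h : hom Z Z'),
    tensm (tensm f g) h >>> assoc X' Y' Z' = assoc X Y Z >>> tensm f (tensm g h);
  lunit_nat : forall (X Y : mon_cat) (f : hom X Y),
    tensm (idm unit_obj) f >>> lunit Y = lunit X >>> f;
  runit_nat : forall (X Y : mon_cat) (f : hom X Y),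
    tensm f (idm unit_obj) >>> runit Y = runit X >>> f;
  pentagon : forall X Y Z T : mon_cat,
    assoc (tens X Y) Z T >>> assoc X Y (tens Z T)
    = tensm (assoc X Y Z) (idm T) >>> assoc X (tens Y Z) T
        >>> tensm (idm X) (assoc Y Z T);
  triangle : forall X Y : mon_cat,
    assoc X unit_obj Y >>> tensm (idm X) (lunit Y) = tensm (runit X) (idm Y)
}.

Arguments tens {k m} X Y.
Arguments tensm {k m X X' Y Y'} f g.
Arguments unit_obj {k m}.
Arguments assoc {k m} X Y Z.
Arguments assocV {k m} X Y Z.
Arguments lunit {k m} X.
Arguments lunitV {k m} X.
Arguments runit {k m} X.
Arguments runitV {k m} X.

Notation "X ⊗ Y" := (tens X Y) : cat_scope.
Notation "f ⊠ g" := (tensm f g) : cat_scope.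

(* D is a dual of V, with evaluation D ⊗ V -> 1 and coevaluation 1 -> V ⊗ D. *)
Definition is_dual (k : fieldType) (C : monoidal_category k) (V D : C)
    (e : hom (D ⊗ V) unit_obj) (c : hom unit_obj (V ⊗ D)) : Prop :=
  lunitV V >>> c ⊠ idm V >>> assoc V D V >>> idm V ⊠ e >>> runit V = idm V /\
  runitV D >>> idm D ⊠ c >>> assocV D V D >>> e ⊠ idm D >>> lunit D = idm D.

(* The duality V |-> V^* is a chosen datum.  Rigidity also demands duals on the
   other side: every V is itself of the form W^*, up to isomorphism. *)
Record rigid_category (k : fieldType) := RigidCategory {
  rigid_mon :> monoidal_category k;
  dual : rigid_mon -> rigid_mon;
  ev : forall V, hom (dual V ⊗ V) unit_obj;
  coev : forall V, hom unit_obj (V ⊗ dual V);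
  dualP : forall V, is_dual (ev V) (coev V);
  predualP : forall V : rigid_mon,
    exists (W : rigid_mon) (e : hom (V ⊗ W) unit_obj) (c : hom unit_obj (W ⊗ V)),
      is_dual e c
}.

Arguments dual {k r} V.
Arguments ev {k r} V.
Arguments coev {k r} V.

Record fusion_category (k : fieldType) := FusionCategory {
  fusion_rigid :> rigid_category k;
  fusion_semisimple : semisimple_category fusion_rigid;
  fusion_finite : finitely_many_simples fusion_rigid;
  fusion_unit : bijective (fun a : k => a *: idm (@unit_obj k fusion_rigid))
}.

(** * Tensor functors and their isomorphisms *)

(* Only the data: the tensor functor axioms are not included, since an
   isomorphism of tensor functors is a condition on the data alone.  Nothing is
   lost when one side satisfies the axioms: they transport along
   [tensor_isomorphic]. *)
Record tensor_functor_data (k : fieldType) (C D : monoidal_category k) :=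
  TensorFunctorData {
  fobj :> C -> D;
  fmap : forall X Y, hom X Y -> hom (fobj X) (fobj Y);
  ftens : forall X Y, hom (fobj X ⊗ fobj Y) (fobj (X ⊗ Y));
  funit : hom unit_obj (fobj unit_obj)
}.

Arguments fmap {k C D} t {X Y} f.
Arguments ftens {k C D} t X Y.
Arguments funit {k C D} t.

Definition id_tensor_functor (k : fieldType) (C : monoidal_category k) :
    tensor_functor_data C C :=
  {| fobj := fun X => X;
     fmap := fun X Y f => f;
     ftens := fun X Y => idm (X ⊗ Y);
     funit := idm unit_obj |}.

Definition comp_tensor_functor (k : fieldType) (C D E : monoidal_category k)
    (F : tensor_functor_data C D) (G : tensor_functor_data D E) :
    tensor_functor_data C E :=
  {| fobj := fun X => G (F X);
     fmap := fun X Y f => fmap G (fmap F f);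
     ftens := fun X Y => ftens G (F X) (F Y) >>> fmap G (ftens F X Y);
     funit := funit G >>> fmap G (funit F) |}.

Definition tensor_isomorphic (k : fieldType) (C D : monoidal_category k)
    (F G : tensor_functor_data C D) : Prop :=
  exists eta : forall X : C, hom (F X) (G X),
  [/\ forall X, is_iso (eta X),
      forall X Y (f : hom X Y), fmap F f >>> eta Y = eta X >>> fmap G f,
      forall X Y, ftens F X Y >>> eta (X ⊗ Y) = eta X ⊠ eta Y >>> ftens G X Y
    & funit F >>> eta unit_obj = funit G].

(** * The double dual as a tensor functor *)

Section DoubleDual.
Variables (k : fieldType) (C : rigid_category k).
Implicit Types V W : C.

Definition dual_map V W (f : hom V W) : hom (dual W) (dual V) :=
  runitV (dual W) >>> idm (dual W) ⊠ coev V
  >>> idm (dual W) ⊠ (f ⊠ idm (dual V))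
  >>> assocV (dual W) W (dual V) >>> ev W ⊠ idm (dual V) >>> lunit (dual V).

(* If (D, e) and (D', c) belong to two duals of V, this is the unique
   isomorphism D -> D' compatible with evaluations and coevaluations. *)
Definition dual_compare V (D D' : C)
    (e : hom (D ⊗ V) unit_obj) (c : hom unit_obj (V ⊗ D')) : hom D D' :=
  runitV D >>> idm D ⊠ c >>> assocV D V D' >>> e ⊠ idm D' >>> lunit D'.

(* [ev_tens] and [coev_tens] make W^* ⊗ V^* a dual of V ⊗ W. *)
Definition ev_tens V W : hom ((dual W ⊗ dual V) ⊗ (V ⊗ W)) unit_obj :=
  assoc (dual W) (dual V) (V ⊗ W)
  >>> idm (dual W) ⊠ assocV (dual V) V W
  >>> idm (dual W) ⊠ (ev V ⊠ idm W)
  >>> idm (dual W) ⊠ lunit W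
  >>> ev W.

Definition coev_tens V W : hom unit_obj ((V ⊗ W) ⊗ (dual W ⊗ dual V)) :=
  coev V
  >>> idm V ⊠ lunitV (dual V)
  >>> idm V ⊠ (coev W ⊠ idm (dual V))
  >>> idm V ⊠ assoc W (dual W) (dual V)
  >>> assocV V W (dual W ⊗ dual V).

(* The canonical isomorphism (V ⊗ W)^* ≅ W^* ⊗ V^* and its inverse. *)
Definition dual_tens V W : hom (dual (V ⊗ W)) (dual W ⊗ dual V) :=
  dual_compare (ev (V ⊗ W)) (coev_tens V W).

Definition dual_tensV V W : hom (dual W ⊗ dual V) (dual (V ⊗ W)) :=
  dual_compare (ev_tens V W) (coev (V ⊗ W)).

(* The canonical isomorphism 1^* ≅ 1 and its inverse: 1 is a dual of itself. *)
Definition dual_unit : hom (dual (@unit_obj k C)) unit_obj :=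
  dual_compare (ev unit_obj) (lunitV unit_obj).

Definition dual_unitV : hom (@unit_obj k C) (dual unit_obj) :=
  dual_compare (lunit unit_obj) (coev unit_obj).

(* The tensor structure is the composite
   V^** ⊗ W^** -> [W^* ⊗ V^* ]^* -> [V ⊗ W]^**. *)
Definition double_dual : tensor_functor_data C C :=
  {| fobj := fun V => dual (dual V);
     fmap := fun V W f => dual_map (dual_map f);
     ftens := fun V W =>
       dual_tensV (dual W) (dual V) >>> dual_map (dual_tens V W);
     funit := dual_unitV >>> dual_map dual_unit |}.

Definition quadruple_dual : tensor_functor_data C C :=
  comp_tensor_functor double_dual double_dual.

End DoubleDual.

(* Main.v *)
From HB Require Import structures.
From mathcomp Require Import all_boot all_order all_algebra.
From Stdlib Require Import IndefiniteDescription.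
Require Import Defs.

Set Implicit Arguments.
Unset Strict Implicit.
Unset Printing Implicit Defensive.

Import GRing.Theory.
Local Open Scope ring_scope.
Local Open Scope cat_scope.

(** The idea is that the double dual is a Serre functor in two opposite ways.
    Closing a loop on the right turns a map [A -> A^**] into a scalar, and
    closing a loop on the left turns a map [X^** -> X] into a scalar ([rtrace]
    and [ltrace] below).  Bending strands identifies
    [(p, r) |-> rtrace A (p >>> r)] on [Hom(A, B) x Hom(B, A^** )], and likewise
    the form given by [ltrace] on [Hom(X^**, Z) x Hom(Z, X)], with the composition
    pairing [Hom(1, Z') x Hom(Z', 1) -> End(1) = k], which is perfect because the
    category is semisimple ([from_unit_inj], [from_unit_represent]).  So [**] is
    both the Serre functor and its inverse, and [X] is canonically isomorphic
    to [X^****]: the isomorphism [serre X] is the unique map with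
    [rtrace X^** (q >>> serre X) = ltrace X q] for all [q : X^** -> X].
    Its naturality is the cyclicity of the two traces ([rloop_cyclic],
    [lloop_cyclic]).

    For monoidality, let [q : (X ⊗ Y)^** -> X ⊗ Y], read as a map
    [r : X^** ⊗ Y^** -> X ⊗ Y] through the tensor structure of [**].  The left
    trace of [r] closes the [X] strand on the left, then the [Y] strand on the
    left; the right trace of [r >>> serre X ⊠ serre Y] closes the [Y] strand on
    the right, then the [X] strand on the right ([lloop_tens], [rloop_tens]).
    Using the property of [serre] on one strand at a time, both become the
    diagram with [X] closed on the left and [Y], carrying [serre Y], closed on
    the right; there the order of closing is irrelevant ([loop_swap]).

    Coherence is handled by letting morphisms act on right-nested words.  A
    coevaluation [c : 1 -> V ⊗ D] acts as the natural family
    [cup c T : T -> V ⊗ (D ⊗ T)], an evaluation as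
    [cap e T : D ⊗ (V ⊗ T) -> T], and a morphism [f] as [f ▷ T].  For these
    families the string diagram moves are plain naturality ([cup_nat],
    [cap_nat]) and cancellation ([zigzag_cancel], [zagzig_cancel]) with no
    associators, and an equation of families at [T = 1] gives back the equation
    of morphisms. *)

(** * Linear categories *)

Notation "X ◁ f" := (idm X ⊠ f) (at level 36, right associativity) : cat_scope.
Notation "f ▷ T" := (f ⊠ idm T) (at level 33, left associativity) : cat_scope.

Section Linear.
Variables (k : fieldType) (C : linear_category k).
Implicit Types X Y Z : C.

(** Rewrites with an equation on a two-fold composite inside a right-associated
    one. *)
Lemma comp_rassoc X Y Z T (f : hom X Y) (g : hom Y Z) (h : hom X Z) (l : hom Z T) :
  f >>> g = h -> f >>> (g >>> l) = h >>> l.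
Proof. by move=> <-; rewrite comp_assoc. Qed.

Lemma compPl X Y Z a (f f' : hom X Y) (g : hom Y Z) :
  (a *: f + f') >>> g = a *: (f >>> g) + (f' >>> g).
Proof. exact: (comp_linearl g). Qed.

Lemma compPr X Y Z a (f : hom X Y) (g g' : hom Y Z) :
  f >>> (a *: g + g') = a *: (f >>> g) + (f >>> g').
Proof. exact: (comp_linearr f). Qed.

Lemma compDl X Y Z (f f' : hom X Y) (g : hom Y Z) :
  (f + f') >>> g = (f >>> g) + (f' >>> g).
Proof. by have := compPl 1 f f' g; rewrite !scale1r. Qed.

Lemma compDr X Y Z (f : hom X Y) (g g' : hom Y Z) :
  f >>> (g + g') = (f >>> g) + (f >>> g').
Proof. by have := compPr 1 f g g'; rewrite !scale1r. Qed.

Lemma comp0l X Y Z (g : hom Y Z) : (0 : hom X Y) >>> g = 0.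
Proof. by apply: (addIr (0 >>> g)); rewrite -compDl !add0r. Qed.

Lemma comp0r X Y Z (f : hom X Y) : f >>> (0 : hom Y Z) = 0.
Proof. by apply: (addIr (f >>> 0)); rewrite -compDr !add0r. Qed.

Lemma compZl X Y Z a (f : hom X Y) (g : hom Y Z) :
  (a *: f) >>> g = a *: (f >>> g).
Proof. by have := compPl a f 0 g; rewrite comp0l !addr0. Qed.

Lemma comp_suml X Y Z n (F : 'I_n -> hom X Y) (g : hom Y Z) :
  (\sum_(j < n) F j) >>> g = \sum_(j < n) (F j >>> g).
Proof.
apply: (big_morph (fun f => f >>> g)) => [f f'|]; [exact: compDl|exact: comp0l].
Qed.

Lemma comp_sumr X Y Z n (f : hom X Y) (F : 'I_n -> hom Y Z) :
  f >>> (\sum_(j < n) F j) = \sum_(j < n) (f >>> F j).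
Proof.
apply: (big_morph (fun g => f >>> g)) => [g g'|]; [exact: compDr|exact: comp0r].
Qed.

Lemma iso_cancelr X Y Z (f f' : hom X Y) (g : hom Y Z) (g' : hom Z Y) :
  g >>> g' = idm Y -> f >>> g = f' >>> g -> f = f'.
Proof. by move=> gK e; rewrite -(comp_idr f) -gK comp_assoc e -comp_assoc gK comp_idr. Qed.

Lemma iso_cancell X Y Z (f f' : hom Y Z) (g : hom X Y) (g' : hom Y X) :
  g' >>> g = idm Y -> g >>> f = g >>> f' -> f = f'.
Proof. by move=> gK e; rewrite -(comp_idl f) -gK -comp_assoc e comp_assoc gK comp_idl. Qed.

(** Schur's lemma: the kernel of [f] is a mono into [X], and it is not all of
    [X], so it vanishes; then [f] is itself a mono into the simple object [Y]. *)
Lemma schur X Y (f : hom X Y) :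
  abelian_category C -> simple_obj X -> simple_obj Y -> f != 0 -> is_iso f.
Proof.
move=> [_ kerC _ _ _] [nzX sX] [_ sY] nzf.
have [K [i [if0 iU]]] := kerC _ _ f.
have i_mono : mono i.
  move=> Z g h e; have gi0 : g >>> i >>> f = 0 by rewrite -comp_assoc if0 comp0r.
  by have [u [_ uU]] := iU _ _ gi0; rewrite -(uU g) // -(uU h).
have [[_ K0]|[j [_ ji]]] := sX _ _ i_mono; last first.
  by case/eqP: nzf; rewrite -(comp_idl f) -ji -comp_assoc if0 comp0r.
have f_mono : mono f.
  move=> Z g h e; have gh0 : (g - h) >>> f = 0.
    by rewrite -scaleN1r addrC compPl e scaleN1r addNr.
  have [u [ui _]] := iU _ _ gh0.
  by apply/eqP; rewrite -subr_eq0 -ui (K0 _ u) comp0l.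
by case: (sY _ _ f_mono).
Qed.

End Linear.

(** * Associators and unitors *)

Section Monoidal.
Variables (k : fieldType) (C : monoidal_category k).
Implicit Types A B D E P Q R S T U V W X Y Z : C.

Lemma tensmPl X X' Y Y' a (f f' : hom X X') (g : hom Y Y') :
  (a *: f + f') ⊠ g = a *: (f ⊠ g) + f' ⊠ g.
Proof. exact: (tensm_linearl g). Qed.

Lemma tensmPr X X' Y Y' a (f : hom X X') (g g' : hom Y Y') :
  f ⊠ (a *: g + g') = a *: (f ⊠ g) + f ⊠ g'.
Proof. exact: (tensm_linearr f). Qed.

Lemma lwhisker_comp X Y Y' Y'' (f : hom Y Y') (g : hom Y' Y'') :
  X ◁ (f >>> g) = X ◁ f >>> X ◁ g.
Proof. by rewrite -tensm_comp comp_idl. Qed.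

Lemma rwhisker_comp X Y Y' Y'' (f : hom Y Y') (g : hom Y' Y'') :
  (f >>> g) ▷ X = f ▷ X >>> g ▷ X.
Proof. by rewrite -tensm_comp comp_idl. Qed.

Lemma interchange X X' Y Y' (f : hom X X') (g : hom Y Y') :
  f ▷ Y >>> X' ◁ g = X ◁ g >>> f ▷ Y'.
Proof. by rewrite -!tensm_comp !comp_idl !comp_idr. Qed.

Lemma lwhiskerK X Y Y' (f : hom Y Y') g : f >>> g = idm Y ->
  X ◁ f >>> X ◁ g = idm (X ⊗ Y).
Proof. by rewrite -lwhisker_comp => ->; rewrite tensm_id. Qed.

Lemma rwhiskerK X Y Y' (f : hom Y Y') g : f >>> g = idm Y ->
  f ▷ X >>> g ▷ X = idm (Y ⊗ X).
Proof. by rewrite -rwhisker_comp => ->; rewrite tensm_id. Qed.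

Lemma assocl_nat X Y Z Z' (h : hom Z Z') :
  (X ⊗ Y) ◁ h >>> assoc X Y Z' = assoc X Y Z >>> X ◁ Y ◁ h.
Proof. by rewrite -assoc_nat tensm_id. Qed.

Lemma assocm_nat X Y Y' Z (h : hom Y Y') :
  (X ◁ h) ▷ Z >>> assoc X Y' Z = assoc X Y Z >>> X ◁ h ▷ Z.
Proof. exact: assoc_nat. Qed.

Lemma assocr_nat X X' Y Z (h : hom X X') :
  h ▷ Y ▷ Z >>> assoc X' Y Z = assoc X Y Z >>> h ▷ (Y ⊗ Z).
Proof. by rewrite assoc_nat tensm_id. Qed.

Lemma assocV_nat X X' Y Y' Z Z' (f : hom X X') (g : hom Y Y') (h : hom Z Z') :
  f ⊠ (g ⊠ h) >>> assocV X' Y' Z' = assocV X Y Z >>> f ⊠ g ⊠ h.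
Proof.
apply: (@iso_cancelr _ _ _ _ _ _ _ (assoc X' Y' Z') (assocV _ _ _)).
  exact: assocK.
rewrite -!comp_assoc assocVK comp_idr assoc_nat.
by rewrite comp_assoc assocVK comp_idl.
Qed.

Lemma assocVl_nat X Y Z Z' (h : hom Z Z') :
  X ◁ Y ◁ h >>> assocV X Y Z' = assocV X Y Z >>> (X ⊗ Y) ◁ h.
Proof. by rewrite assocV_nat tensm_id. Qed.

Lemma assocVm_nat X Y Y' Z (h : hom Y Y') :
  X ◁ h ▷ Z >>> assocV X Y' Z = assocV X Y Z >>> (X ◁ h) ▷ Z.
Proof. exact: assocV_nat. Qed.

Lemma assocVr_nat X X' Y Z (h : hom X X') :
  h ▷ (Y ⊗ Z) >>> assocV X' Y Z = assocV X Y Z >>> h ▷ Y ▷ Z.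
Proof. by rewrite -assocV_nat tensm_id. Qed.

Lemma lunitV_nat X Y (f : hom X Y) : lunitV X >>> unit_obj ◁ f = f >>> lunitV Y.
Proof.
apply: (iso_cancelr (lunitK Y)); rewrite -!comp_assoc lunitVK comp_idr.
by rewrite lunit_nat comp_assoc lunitVK comp_idl.
Qed.

Lemma runitV_nat X Y (f : hom X Y) : runitV X >>> f ▷ unit_obj = f >>> runitV Y.
Proof.
apply: (iso_cancelr (runitK Y)); rewrite -!comp_assoc runitVK comp_idr.
by rewrite runit_nat comp_assoc runitVK comp_idl.
Qed.

Lemma lwhisker_unit_inj X Y (f g : hom X Y) :
  unit_obj ◁ f = unit_obj ◁ g -> f = g.
Proof.
by move=> e; apply: (iso_cancell (lunitVK X)); rewrite -!lunit_nat e.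
Qed.

Lemma rwhisker_unit_inj X Y (f g : hom X Y) : f ▷ unit_obj = g ▷ unit_obj -> f = g.
Proof.
by move=> e; apply: (iso_cancell (runitVK X)); rewrite -!runit_nat e.
Qed.

(** Kelly's coherence lemma: after whiskering with the unit, the pentagon for
    [1, 1, X, Y] and two triangles give it. *)
Lemma lunit_tens X Y : assoc unit_obj X Y >>> lunit (X ⊗ Y) = lunit X ▷ Y.
Proof.
apply: lwhisker_unit_inj; rewrite lwhisker_comp.
apply: (iso_cancell (assocVK unit_obj (unit_obj ⊗ X) Y)).
apply: (iso_cancell (rwhiskerK Y (assocVK unit_obj unit_obj X))).
rewrite !comp_assoc -pentagon -!comp_assoc triangle -assocm_nat.
by rewrite -assocr_nat !comp_assoc -rwhisker_comp triangle.
Qed.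

Lemma lunitV_tens X Y : lunitV X ▷ Y >>> assoc unit_obj X Y = lunitV (X ⊗ Y).
Proof.
apply: (iso_cancelr (lunitK (X ⊗ Y))).
by rewrite -comp_assoc lunit_tens lunitVK; apply: rwhiskerK; apply: lunitVK.
Qed.

Lemma lunit_unit : lunit unit_obj = runit unit_obj :> hom (@unit_obj _ C ⊗ _) _.
Proof.
apply: rwhisker_unit_inj; rewrite -lunit_tens -triangle; congr (_ >>> _).
by apply: (iso_cancelr (lunitK unit_obj)); rewrite lunit_nat.
Qed.

Lemma triangleV X Y : runitV X ▷ Y >>> assoc X unit_obj Y = X ◁ lunitV Y.
Proof.
apply: (iso_cancelr (lwhiskerK X (lunitK Y))).
rewrite -comp_assoc triangle.
by rewrite (rwhiskerK Y (runitVK X)) (lwhiskerK X (lunitVK Y)).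
Qed.

Lemma pentagonV X Y Z T :
  assocV X Y Z ▷ T >>> assoc (X ⊗ Y) Z T >>> assoc X Y (Z ⊗ T)
  = assoc X (Y ⊗ Z) T >>> X ◁ assoc Y Z T.
Proof.
by rewrite -comp_assoc pentagon !comp_assoc (rwhiskerK T (assocVK X Y Z)) comp_idl.
Qed.

End Monoidal.

(** * Cups and caps acting on words *)

Section CupsAndCaps.
Variables (k : fieldType) (C : monoidal_category k).
Implicit Types D P S T V : C.

(** [cup] and [cap] are locked so that lemmas on composites do not match inside
    them. *)
Definition cup V D (c : hom unit_obj (V ⊗ D)) T : hom T (V ⊗ (D ⊗ T)) :=
  locked (lunitV T >>> c ▷ T >>> assoc V D T).

Definition cap V D (e : hom (D ⊗ V) unit_obj) T : hom (D ⊗ (V ⊗ T)) T :=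
  locked (assocV D V T >>> e ▷ T >>> lunit T).

Lemma cupE V D (c : hom unit_obj (V ⊗ D)) T :
  cup c T = lunitV T >>> c ▷ T >>> assoc V D T.
Proof. by rewrite /cup -lock. Qed.

Lemma capE V D (e : hom (D ⊗ V) unit_obj) T :
  cap e T = assocV D V T >>> e ▷ T >>> lunit T.
Proof. by rewrite /cap -lock. Qed.

Lemma cup_nat V D (c : hom unit_obj (V ⊗ D)) T T' (f : hom T T') :
  cup c T >>> V ◁ D ◁ f = f >>> cup c T'.
Proof.
rewrite !cupE -!comp_assoc -assocl_nat (comp_rassoc _ (interchange _ _)).
by rewrite !comp_assoc lunitV_nat.
Qed.

Lemma cap_nat V D (e : hom (D ⊗ V) unit_obj) T T' (f : hom T T') :
  D ◁ V ◁ f >>> cap e T' = cap e T >>> f.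
Proof.
rewrite !capE !comp_assoc assocVl_nat -!comp_assoc (comp_rassoc _ (esym (interchange _ _))).
by rewrite -!comp_assoc lunit_nat.
Qed.

Lemma cup_rwhisker V V' D (c : hom unit_obj (V ⊗ D)) (f : hom V V') T :
  cup (c >>> f ▷ D) T = cup c T >>> f ▷ (D ⊗ T).
Proof. by rewrite !cupE rwhisker_comp -!comp_assoc assocr_nat. Qed.

Lemma cup_lwhisker V D D' (c : hom unit_obj (V ⊗ D)) (f : hom D D') T :
  cup (c >>> V ◁ f) T = cup c T >>> V ◁ f ▷ T.
Proof. by rewrite !cupE rwhisker_comp -!comp_assoc assocm_nat. Qed.

Lemma cap_rwhisker V D D' (e : hom (D' ⊗ V) unit_obj) (f : hom D D') T :
  cap (f ▷ V >>> e) T = f ▷ (V ⊗ T) >>> cap e T.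
Proof. by rewrite !capE rwhisker_comp !comp_assoc assocVr_nat. Qed.

Lemma cap_lwhisker V V' D (e : hom (D ⊗ V') unit_obj) (f : hom V V') T :
  cap (D ◁ f >>> e) T = D ◁ f ▷ T >>> cap e T.
Proof. by rewrite !capE rwhisker_comp !comp_assoc assocVm_nat. Qed.

(** [cup_tens] and [cap_tens] say that the families are compatible with tensoring
    on the right, as families of the form [f ▷ T] are; this makes it possible to
    recover an actual morphism from a family built out of cups and caps. *)
Lemma cup_tens V D (c : hom unit_obj (V ⊗ D)) S T :
  cup c S ▷ T >>> assoc V (D ⊗ S) T >>> V ◁ assoc D S T = cup c (S ⊗ T).
Proof.
rewrite !cupE !rwhisker_comp -lunitV_tens -!comp_assoc.
by rewrite (comp_assoc (assoc V D S ▷ T)) -pentagon (comp_rassoc _ (assocr_nat _ _ _)) -!comp_assoc.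
Qed.

Lemma cap_tens V D (e : hom (D ⊗ V) unit_obj) S T :
  D ◁ assoc V S T >>> cap e (S ⊗ T) = assocV D (V ⊗ S) T >>> cap e S ▷ T.
Proof.
apply: (iso_cancell (assocVK D (V ⊗ S) T)).
rewrite !comp_assoc assocK comp_idl !capE !rwhisker_comp -lunit_tens !comp_assoc -pentagonV.
rewrite -!comp_assoc (comp_rassoc _ (assocK _ _ _)) comp_idl (comp_rassoc _ (assocr_nat _ _ _)).
by rewrite -!comp_assoc.
Qed.

Lemma cup_inj V D (c c' : hom unit_obj (V ⊗ D)) :
  cup c unit_obj = cup c' unit_obj -> c = c'.
Proof.
rewrite !cupE => e; apply: rwhisker_unit_inj.
apply: (iso_cancell (lunitK _)); apply: (iso_cancelr (assocK _ _ _)).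
exact: e.
Qed.

Lemma cap_inj V D (e e' : hom (D ⊗ V) unit_obj) :
  cap e unit_obj = cap e' unit_obj -> e = e'.
Proof.
rewrite !capE => E; apply: rwhisker_unit_inj.
apply: (iso_cancell (assocK _ _ _)); apply: (iso_cancelr (lunitK _)).
exact: E.
Qed.

End CupsAndCaps.

(** * Bending strands *)

Section Bending.
Variables (k : fieldType) (C : monoidal_category k).
Implicit Types A B D E P Q R S T U V W X Y Z : C.

Lemma lwhisker_cup P Q D (c : hom unit_obj (Q ⊗ D)) T :
  P ◁ cup c T >>> assocV P Q (D ⊗ T)
  = (runitV P >>> P ◁ c >>> assocV P Q D) ▷ T >>> assoc (P ⊗ Q) D T.
Proof.
apply: (iso_cancelr (assocK P Q (D ⊗ T))).
rewrite -comp_assoc assocVK comp_idr !rwhisker_comp -!comp_assoc.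
rewrite (comp_assoc (assocV P Q D ▷ T)) pentagonV.
rewrite (comp_assoc ((P ◁ c) ▷ T)) assocm_nat.
by rewrite !comp_assoc triangleV cupE !lwhisker_comp.
Qed.

Lemma lwhisker_cap A B D (g : hom (B ⊗ D) unit_obj) T :
  assoc (A ⊗ B) D T >>> assoc A B (D ⊗ T) >>> A ◁ cap g T
  = (assoc A B D >>> A ◁ g >>> runit A) ▷ T.
Proof.
rewrite pentagon capE !lwhisker_comp !rwhisker_comp -!comp_assoc; congr (_ >>> _).
rewrite (comp_assoc (A ◁ assoc _ _ _)) (lwhiskerK A (assocK B D T)) comp_idl.
by rewrite (comp_rassoc _ (esym (assocm_nat _ _ _))) -!comp_assoc triangle.
Qed.

(** Both zigzag composites are kept for unrelated [c] and [e]: applied to the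
    coevaluation and evaluation of a dual they are the two sides of the zigzag
    identities, and in general they are the inverse bijections of the adjunctions
    [Hom(V, B) = Hom(1, B ⊗ V^* )] and [Hom(V^* ⊗ V', 1) = Hom(V', V)] for [bend],
    and of their mirror images for [cobend]. *)
Definition bend V B D (c : hom unit_obj (B ⊗ D)) (e : hom (D ⊗ V) unit_obj) :
    hom V B :=
  lunitV V >>> c ▷ V >>> assoc B D V >>> B ◁ e >>> runit B.

Definition cobend V D D' (e : hom (D ⊗ V) unit_obj) (c : hom unit_obj (V ⊗ D')) :
    hom D D' :=
  runitV D >>> D ◁ c >>> assocV D V D' >>> e ▷ D' >>> lunit D'.

Lemma cobend_whisker V D D' (e : hom (D ⊗ V) unit_obj)
    (c : hom unit_obj (V ⊗ D')) T :
  cobend e c ▷ T = D ◁ cup c T >>> cap e (D' ⊗ T).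
Proof.
rewrite capE !comp_assoc lwhisker_cup /cobend !rwhisker_comp -!comp_assoc.
by rewrite (comp_rassoc _ (esym (assocr_nat _ _ _))) -!comp_assoc lunit_tens.
Qed.

Lemma bend_whisker V B D (c : hom unit_obj (B ⊗ D)) (e : hom (D ⊗ V) unit_obj) T :
  bend c e ▷ T = cup c (V ⊗ T) >>> B ◁ cap e T.
Proof.
rewrite cupE /bend -(comp_assoc _ (assoc _ _ _)) -comp_assoc.
rewrite -(comp_assoc (_ >>> _)) -lunitV_tens rwhisker_comp -lwhisker_cap -!comp_assoc.
rewrite !rwhisker_comp (comp_rassoc _ (esym (assocr_nat _ _ _))) -!comp_assoc //.
Qed.

(** This half of [is_dual], for the dual [(D, e, c)], is what makes maps into or
    out of [D] compatible with evaluations and coevaluations ([coev_cobend],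
    [cobend_ev]). *)
Definition zigzag V D (e : hom (D ⊗ V) unit_obj) (c : hom unit_obj (V ⊗ D)) : Prop :=
  bend c e = idm V.

Lemma zigzag_cancel V D (e : hom (D ⊗ V) unit_obj) (c : hom unit_obj (V ⊗ D)) T :
  zigzag e c -> cup c (V ⊗ T) >>> V ◁ cap e T = idm (V ⊗ T).
Proof. by move=> ec; rewrite -bend_whisker ec tensm_id. Qed.

Lemma zagzig_cancel V D (e : hom (D ⊗ V) unit_obj) (c : hom unit_obj (V ⊗ D)) T :
  cobend e c = idm D -> D ◁ cup c T >>> cap e (D ⊗ T) = idm (D ⊗ T).
Proof. by move=> ec; rewrite -cobend_whisker ec tensm_id. Qed.

Lemma coev_cobend V D D' (e : hom (D ⊗ V) unit_obj)
    (c0 : hom unit_obj (V ⊗ D)) (c : hom unit_obj (V ⊗ D')) :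
  zigzag e c0 -> c0 >>> V ◁ cobend e c = c.
Proof.
move=> ec0; apply: cup_inj; rewrite cup_lwhisker cobend_whisker lwhisker_comp.
by rewrite comp_assoc cup_nat -comp_assoc zigzag_cancel ?comp_idr.
Qed.

Lemma cobend_ev V D D' (e : hom (D ⊗ V) unit_obj)
    (c : hom unit_obj (V ⊗ D')) (e0 : hom (D' ⊗ V) unit_obj) :
  zigzag e0 c -> cobend e c ▷ V >>> e0 = e.
Proof.
move=> e0c; apply: cap_inj; rewrite cap_rwhisker cobend_whisker.
by rewrite -comp_assoc -cap_nat comp_assoc -lwhisker_comp zigzag_cancel ?tensm_id ?comp_idl.
Qed.

Lemma coev_bend V B D (c0 : hom unit_obj (V ⊗ D)) (e : hom (D ⊗ V) unit_obj)
    (c : hom unit_obj (B ⊗ D)) :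
  cobend e c0 = idm D -> c0 >>> bend c e ▷ D = c.
Proof.
move=> ec0; apply: cup_inj; rewrite cup_rwhisker bend_whisker comp_assoc.
by rewrite -cup_nat -comp_assoc -lwhisker_comp zagzig_cancel ?tensm_id ?comp_idr.
Qed.

Lemma bend_ev V B D (c : hom unit_obj (B ⊗ D)) (e : hom (D ⊗ V) unit_obj)
    (e0 : hom (D ⊗ B) unit_obj) :
  cobend e0 c = idm D -> D ◁ bend c e >>> e0 = e.
Proof.
move=> e0c; apply: cap_inj; rewrite cap_lwhisker bend_whisker lwhisker_comp.
by rewrite -comp_assoc cap_nat comp_assoc zagzig_cancel ?comp_idl.
Qed.

Lemma cobend_precomp V D D' E (q : hom E D) (e : hom (D ⊗ V) unit_obj)
    (c : hom unit_obj (V ⊗ D')) :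
  cobend (q ▷ V >>> e) c = q >>> cobend e c.
Proof.
rewrite /cobend rwhisker_comp !comp_assoc -runitV_nat -!comp_assoc.
by rewrite (comp_rassoc _ (interchange _ _))
  -!comp_assoc (comp_rassoc _ (assocVr_nat _ _ _)) -!comp_assoc.
Qed.

Lemma cobend_postcomp V D D' E (p : hom D' E) (e : hom (D ⊗ V) unit_obj)
    (c : hom unit_obj (V ⊗ D')) :
  cobend e (c >>> V ◁ p) = cobend e c >>> p.
Proof.
rewrite /cobend lwhisker_comp -!comp_assoc -lunit_nat.
by rewrite (comp_rassoc _ (assocVl_nat _ _ _))
  -!comp_assoc (comp_rassoc _ (esym (interchange _ _))) -!comp_assoc.
Qed.

(** The two usual formulas for the dual of a morphism agree. *)
Lemma cobend_slide V W D D' (f : hom V W) (e : hom (D ⊗ W) unit_obj)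
    (c : hom unit_obj (V ⊗ D')) :
  cobend (D ◁ f >>> e) c = cobend e (c >>> f ▷ D').
Proof.
rewrite /cobend lwhisker_comp rwhisker_comp -!comp_assoc.
by rewrite (comp_rassoc _ (assocVm_nat _ _ _)) -!comp_assoc.
Qed.

Lemma bend_precomp V B D U (q : hom U V) (c : hom unit_obj (B ⊗ D)) (e : hom (D ⊗ V) unit_obj) :
  bend c (D ◁ q >>> e) = q >>> bend c e.
Proof.
rewrite /bend lwhisker_comp !comp_assoc -lunitV_nat -!comp_assoc.
by rewrite (comp_rassoc _ (esym (interchange _ _)))
  -!comp_assoc (comp_rassoc _ (assocl_nat _ _ _)) -!comp_assoc.
Qed.

Lemma bend_postcomp V B D U (p : hom B U) (c : hom unit_obj (B ⊗ D)) (e : hom (D ⊗ V) unit_obj) :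
  bend (c >>> p ▷ D) e = bend c e >>> p.
Proof.
rewrite /bend rwhisker_comp -!comp_assoc -runit_nat.
by rewrite (comp_rassoc _ (assocr_nat _ _ _))
  -!comp_assoc (comp_rassoc _ (interchange _ _)) -!comp_assoc.
Qed.

End Bending.

(** * Closing strands *)

Section Closing.
Variables (k : fieldType) (C : monoidal_category k).
Implicit Types A B D E P Q T : C.

Definition rloop P A D (c : hom unit_obj (P ⊗ D)) (f : hom P A)
    (e : hom (A ⊗ D) unit_obj) : hom unit_obj unit_obj := c >>> f ▷ D >>> e.

Definition lloop P A D (c : hom unit_obj (D ⊗ P)) (f : hom P A)
    (e : hom (D ⊗ A) unit_obj) : hom unit_obj unit_obj := c >>> D ◁ f >>> e.

(** The partial traces of [r]: [rclose] closes the second strand on the right,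
    [lclose] closes the first strand on the left. *)
Definition rclose P Q A B D (c : hom unit_obj (Q ⊗ D)) (r : hom (P ⊗ Q) (A ⊗ B))
    (e : hom (B ⊗ D) unit_obj) : hom P A :=
  runitV P >>> P ◁ c >>> assocV P Q D >>> r ▷ D >>> assoc A B D >>> A ◁ e >>> runit A.

Definition lclose P Q A B D (c : hom unit_obj (D ⊗ P)) (r : hom (P ⊗ Q) (A ⊗ B))
    (e : hom (D ⊗ A) unit_obj) : hom Q B :=
  cup c Q >>> D ◁ r >>> cap e B.

(** The action of a two-strand morphism on right-nested words. *)
Definition box P Q A B (r : hom (P ⊗ Q) (A ⊗ B)) T : hom (P ⊗ (Q ⊗ T)) (A ⊗ (B ⊗ T)) :=
  locked (assocV P Q T >>> r ▷ T >>> assoc A B T).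

Lemma boxE P Q A B (r : hom (P ⊗ Q) (A ⊗ B)) T :
  box r T = assocV P Q T >>> r ▷ T >>> assoc A B T.
Proof. by rewrite /box -lock. Qed.

Lemma rclose_whisker P Q A B D (c : hom unit_obj (Q ⊗ D)) (r : hom (P ⊗ Q) (A ⊗ B))
    (e : hom (B ⊗ D) unit_obj) T :
  rclose c r e ▷ T = P ◁ cup c T >>> box r (D ⊗ T) >>> A ◁ cap e T.
Proof.
rewrite boxE !comp_assoc lwhisker_cup -(comp_assoc _ (assoc (P ⊗ Q) _ _)) -assocr_nat.
rewrite comp_assoc -(comp_assoc _ (assoc (A ⊗ B) _ _)) -(comp_assoc _ (_ >>> _)) lwhisker_cap.
by rewrite -!rwhisker_comp /rclose -!comp_assoc.
Qed.

Lemma rclose_postcomp P Q A A' B B' D (c : hom unit_obj (Q ⊗ D))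
    (r : hom (P ⊗ Q) (A ⊗ B)) (f : hom A A') (g : hom B B') (e : hom (B' ⊗ D) unit_obj) :
  rclose c (r >>> f ⊠ g) e = rclose c r (g ▷ D >>> e) >>> f.
Proof.
rewrite /rclose rwhisker_comp -!comp_assoc -runit_nat.
rewrite (comp_rassoc _ (assoc_nat _ _ _)) -!comp_assoc.
do 5!congr (_ >>> _).
by rewrite !comp_assoc; congr (_ >>> _); rewrite -!tensm_comp !comp_idl !comp_idr.
Qed.

Lemma rloop_comp P A B D (c : hom unit_obj (P ⊗ D)) (f : hom P A) (g : hom A B)
    (e : hom (B ⊗ D) unit_obj) :
  rloop c (f >>> g) e = rloop c f (g ▷ D >>> e).
Proof. by rewrite /rloop rwhisker_comp !comp_assoc. Qed.

Lemma lclose_whisker P Q A B D (c : hom unit_obj (D ⊗ P)) (r : hom (P ⊗ Q) (A ⊗ B))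
    (e : hom (D ⊗ A) unit_obj) T :
  lclose c r e ▷ T = cup c (Q ⊗ T) >>> D ◁ box r T >>> cap e (B ⊗ T).
Proof.
rewrite boxE -cup_tens !lwhisker_comp -!comp_assoc cap_tens.
rewrite (comp_assoc (D ◁ assoc P Q T)) (lwhiskerK D (assocK P Q T)) comp_idl.
rewrite (comp_assoc (D ◁ r ▷ T)) assocVm_nat !comp_assoc.
rewrite -(comp_assoc _ (assoc _ _ _)) assocK comp_idr.
by rewrite -!rwhisker_comp.
Qed.

(** The action of an endomorphism of the unit on words. *)
Definition scalar (s : hom unit_obj unit_obj) T : hom T T := lunitV T >>> s ▷ T >>> lunit T.

Lemma scalar_inj s s' : scalar s unit_obj = scalar s' unit_obj -> s = s'.
Proof.
move=> E; apply: rwhisker_unit_inj.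
by apply: (iso_cancell (lunitK _)); apply: (iso_cancelr (lunitK _)).
Qed.

Lemma scalar_rloop P A D (c : hom unit_obj (P ⊗ D)) (f : hom P A)
    (e : hom (A ⊗ D) unit_obj) T :
  scalar (rloop c f e) T = cup c T >>> f ▷ (D ⊗ T) >>> cap e T.
Proof.
rewrite -cup_rwhisker capE cupE !comp_assoc -(comp_assoc _ (assoc _ _ _)) assocK comp_idr.
by rewrite /scalar /rloop !rwhisker_comp !comp_assoc.
Qed.

Lemma scalar_lloop P A D (c : hom unit_obj (D ⊗ P)) (f : hom P A)
    (e : hom (D ⊗ A) unit_obj) T :
  scalar (lloop c f e) T = cup c T >>> D ◁ f ▷ T >>> cap e T.
Proof.
rewrite -cup_lwhisker capE cupE !comp_assoc -(comp_assoc _ (assoc _ _ _)) assocK comp_idr.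
by rewrite /scalar /lloop !rwhisker_comp !comp_assoc.
Qed.

(** A loop on the left and a loop on the right do not meet, so they can be closed
    in either order; on words this is the naturality of the cup and the cap of the
    left loop. *)
Lemma loop_swap P Q A B D E (c : hom unit_obj (D ⊗ P)) (e : hom (D ⊗ A) unit_obj)
    (c' : hom unit_obj (Q ⊗ E)) (e' : hom (B ⊗ E) unit_obj) (r : hom (P ⊗ Q) (A ⊗ B)) :
  lloop c (rclose c' r e') e = rloop c' (lclose c r e) e'.
Proof.
apply: scalar_inj; rewrite scalar_lloop scalar_rloop rclose_whisker lclose_whisker.
by rewrite !lwhisker_comp !comp_assoc cup_nat -!comp_assoc cap_nat.
Qed.

End Closing.

(** * Duals *)

Section Rigid.
Variables (k : fieldType) (C : rigid_category k).
Implicit Types A B D P Q R S T U V W X Y Z : C.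

Lemma ev_zigzag V : zigzag (ev V) (coev V).
Proof. exact: (dualP V).1. Qed.

Lemma ev_zagzig V : cobend (ev V) (coev V) = idm (dual V).
Proof. exact: (dualP V).2. Qed.

Lemma dual_mapE V W (f : hom V W) : dual_map f = cobend (ev W) (coev V >>> f ▷ dual V).
Proof. by rewrite /dual_map /cobend lwhisker_comp -!comp_assoc. Qed.

Lemma coev_dual_map V W (f : hom V W) :
  coev W >>> W ◁ dual_map f = coev V >>> f ▷ dual V.
Proof. by rewrite dual_mapE coev_cobend //; apply: ev_zigzag. Qed.

Lemma dual_map_ev V W (f : hom V W) :
  dual_map f ▷ V >>> ev V = dual W ◁ f >>> ev W.
Proof. by rewrite dual_mapE -cobend_slide cobend_ev //; apply: ev_zigzag. Qed.

(** On words, the coevaluation of [V ⊗ W] is that of [V] with the one of [W]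
    nested inside it; dually for evaluations. *)
Lemma cup_coev_tens V W T :
  cup (coev_tens V W) T
  = cup (coev V) T >>> V ◁ cup (coev W) (dual V ⊗ T)
    >>> V ◁ W ◁ assocV (dual W) (dual V) T >>> assocV V W ((dual W ⊗ dual V) ⊗ T).
Proof.
have -> : coev_tens V W = coev V >>> V ◁ cup (coev W) (dual V) >>> assocV _ _ _.
  by rewrite /coev_tens cupE !lwhisker_comp -!comp_assoc.
apply: (iso_cancelr (assocK _ _ _)).
apply: (iso_cancelr (lwhiskerK V (lwhiskerK W (assocK _ _ _)))).
rewrite -!comp_assoc (comp_rassoc _ (assocVK _ _ _)) comp_idl.
rewrite (lwhiskerK V (lwhiskerK W (assocVK _ _ _))) comp_idr.
rewrite -cup_tens !lwhisker_comp !(cupE _ T) !rwhisker_comp -!comp_assoc.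
rewrite (comp_assoc (assocV _ _ _ ▷ T)) (comp_assoc (assocV _ _ _ ▷ T >>> _))
  pentagonV -!comp_assoc.
by rewrite (comp_rassoc _ (assocm_nat _ _ _)) -!comp_assoc.
Qed.

Lemma assocV_conj P Q R R' (f : hom R R') :
  assocV P Q R >>> (P ⊗ Q) ◁ f >>> assoc P Q R' = P ◁ Q ◁ f.
Proof. by rewrite -assocVl_nat -comp_assoc assocVK comp_idr. Qed.

Lemma cap_ev_tens V W T :
  cap (ev_tens V W) T
  = (dual W ⊗ dual V) ◁ assoc V W T >>> assoc (dual W) (dual V) (V ⊗ (W ⊗ T))
    >>> dual W ◁ cap (ev V) (W ⊗ T) >>> cap (ev W) T.
Proof.
have -> : ev_tens V W = assoc _ _ _ >>> dual W ◁ cap (ev V) W >>> ev W.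
  by rewrite /ev_tens capE !lwhisker_comp -!comp_assoc.
rewrite assocl_nat -(comp_assoc _ _ (dual W ◁ cap _ _)) -lwhisker_comp cap_tens lwhisker_comp.
rewrite !(capE _ T) !rwhisker_comp -!comp_assoc.
rewrite (comp_rassoc _ (assocVm_nat _ _ _)) -!comp_assoc !comp_assoc; do 3!congr (_ >>> _).
apply: (iso_cancell (assocVK (dual W ⊗ dual V) (V ⊗ W) T)).
rewrite !comp_assoc assocK comp_idl pentagon.
rewrite -(comp_assoc _ _ (dual W ◁ assocV _ _ _)) (lwhiskerK _ (assocK _ _ _)) comp_idr.
by rewrite -comp_assoc assocK comp_idr.
Qed.

(** Closing two parallel strands with nested arcs on the right: the inner arc
    belongs to [Q]. *)
Lemma rloop_tens P Q (r : hom (P ⊗ Q) (dual (dual P) ⊗ dual (dual Q))) :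
  rloop (coev_tens P Q) r (ev_tens (dual Q) (dual P))
  = rloop (coev P) (rclose (coev Q) r (ev (dual Q))) (ev (dual P)).
Proof.
apply: scalar_inj; rewrite !scalar_rloop rclose_whisker cup_coev_tens cap_ev_tens.
rewrite -!comp_assoc; congr (_ >>> (_ >>> _)).
rewrite (comp_rassoc _ (interchange _ _)) (comp_rassoc _ (assocVl_nat _ _ _)) -!comp_assoc.
rewrite (comp_assoc ((P ⊗ Q) ◁ _)) (lwhiskerK _ (assocVK _ _ _)) comp_idl.
by rewrite boxE -!comp_assoc.
Qed.

(** Closing two parallel strands with nested arcs on the left: the inner arc
    belongs to [A]. *)
Lemma lloop_tens A B (r : hom (dual (dual A) ⊗ dual (dual B)) (A ⊗ B)) :
  lloop (coev_tens (dual B) (dual A)) r (ev_tens A B)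
  = lloop (coev (dual B)) (lclose (coev (dual A)) r (ev A)) (ev B).
Proof.
apply: scalar_inj; rewrite !scalar_lloop lclose_whisker cup_coev_tens cap_ev_tens.
rewrite !(lwhisker_comp (dual B)) -!comp_assoc; congr (_ >>> (_ >>> _)).
rewrite (comp_assoc ((dual B ⊗ dual A) ◁ _)) -lwhisker_comp.
rewrite (comp_assoc ((dual B ⊗ dual A) ◁ _)) !(comp_assoc (assocV (dual B) _ _)).
rewrite assocV_conj comp_assoc; congr (_ >>> _); rewrite -!lwhisker_comp boxE.
by rewrite comp_assoc.
Qed.

Lemma assocV_cap_ev_tens V W T :
  assocV (dual W) (dual V) _ >>> cap (ev_tens V W) T
  = dual W ◁ (dual V ◁ assoc V W T >>> cap (ev V) (W ⊗ T)) >>> cap (ev W) T.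
Proof.
by rewrite cap_ev_tens !comp_assoc assocV_conj lwhisker_comp.
Qed.

Lemma tens_zigzag V W : zigzag (ev_tens V W) (coev_tens V W).
Proof.
apply: rwhisker_unit_inj; rewrite bend_whisker tensm_id cup_coev_tens.
set T := unit_obj; set U := (V ⊗ W) ⊗ T.
apply: (iso_cancelr (assocK V W T)); rewrite comp_idl.
rewrite -(comp_assoc (_ >>> _ >>> _)) -(comp_assoc (_ >>> _ >>> _)).
rewrite assocV_conj -(comp_assoc (_ >>> _)) -!lwhisker_comp assocV_cap_ev_tens.
rewrite -comp_assoc -lwhisker_comp (lwhisker_comp W) comp_assoc cup_nat -comp_assoc.
rewrite zigzag_cancel ?comp_idr; last exact: ev_zigzag.
rewrite lwhisker_comp comp_assoc cup_nat -comp_assoc.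
by rewrite zigzag_cancel ?comp_idr; last exact: ev_zigzag.
Qed.

(** Let [D] be any dual of [X], and [D'] any dual of [D].  The canonical map
    [D' -> X^**] carries the loops drawn with [D] and [D'] to those drawn with
    [X^*] and [X^**].  The tensor and unit structures of the double dual are both
    instances of this map: [D' = V^** ⊗ W^**] for [X = V ⊗ W], and [D' = 1] for
    [X = 1]. *)
Lemma rloop_compare X D D' (c : hom unit_obj (X ⊗ D)) (e' : hom (D' ⊗ D) unit_obj)
    (f : hom X D') :
  rloop (coev X) (f >>> (cobend e' (coev D) >>> dual_map (cobend (ev X) c))) (ev (dual X))
  = rloop c f e'.
Proof.
rewrite /rloop 2!rwhisker_comp -!comp_assoc dual_map_ev.
rewrite (comp_rassoc _ (interchange _ _)) -!comp_assoc cobend_ev; last exact: ev_zigzag.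
rewrite (comp_rassoc _ (interchange _ _)) !comp_assoc coev_cobend //.
exact: ev_zigzag.
Qed.

Lemma lloop_compare X D D' (e : hom (D ⊗ X) unit_obj) (c : hom unit_obj (X ⊗ D))
    (e' : hom (D' ⊗ D) unit_obj) (c' : hom unit_obj (D ⊗ D'))
    (q : hom (dual (dual X)) X) :
  zigzag e c -> zigzag e' c' ->
  lloop (coev (dual X)) q (ev X)
  = lloop c' (cobend e' (coev D) >>> dual_map (cobend (ev X) c) >>> q) e.
Proof.
move=> ec ec'; rewrite /lloop 2!lwhisker_comp -{1}(cobend_ev (ev X) ec) !comp_assoc.
rewrite (coev_cobend _ ec') coev_dual_map -!comp_assoc.
by rewrite (comp_rassoc _ (interchange _ _)) -!comp_assoc.
Qed.

(** Sliding [g] along the dual strand and once more along the double dual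
    strand. *)
Lemma rloop_cyclic A B (g : hom A B) (r : hom B (dual (dual A))) :
  rloop (coev A) (g >>> r) (ev (dual A))
  = rloop (coev B) (r >>> dual_map (dual_map g)) (ev (dual B)).
Proof.
rewrite /rloop 2!rwhisker_comp -!comp_assoc dual_map_ev.
by rewrite (comp_rassoc _ (interchange _ _)) !comp_assoc coev_dual_map.
Qed.

Lemma lloop_cyclic A B (f : hom A B) (s : hom (dual (dual B)) A) :
  lloop (coev (dual A)) (dual_map (dual_map f) >>> s) (ev A)
  = lloop (coev (dual B)) (s >>> f) (ev B).
Proof.
rewrite /lloop 2!lwhisker_comp -!comp_assoc -(dual_map_ev f).
by rewrite (comp_rassoc _ (coev_dual_map _))
  -!comp_assoc (comp_rassoc _ (interchange _ _)) -!comp_assoc.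
Qed.

End Rigid.

(** * Maps to and from the unit in a fusion category *)

Section UnitPairing.
Variables (k : fieldType) (C : fusion_category k).
Implicit Types A B S X Y Z : C.
Notation one := (@unit_obj k C).

Lemma unit_scalar (s : hom one one) : exists a, s = a *: idm one.
Proof. by have [g _ gK] := fusion_unit C; exists (g s); rewrite gK. Qed.

Lemma unit_neq0 : idm one != 0.
Proof.
apply/eqP=> e; have /bij_inj inj := fusion_unit C.
by have /eqP := inj 1 0 (etrans (etrans (congr1 _ e) (scaler0 _ _)) (esym (scale0r _)));
  rewrite oner_eq0.
Qed.

(** In a decomposition of [1] some summand gives a nonzero, hence invertible,
    scalar [p j >>> i j]; that summand is then all of [1]. *)
Lemma unit_iso_simple :
  exists S (i : hom one S), simple_obj S /\ is_iso i.
Proof.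
have [_ /(_ one) [n [S [simS [i [p [ip _ id_sum]]]]]]] := fusion_semisimple C.
have /existsP[j nz] : [exists j, p j >>> i j != 0].
  apply: contraT => /existsPn all0; case/eqP: unit_neq0; rewrite -id_sum.
  by apply: big1 => j _; apply/eqP/negPn.
exists (S j), (p j); split; first exact: simS.
exists (i j); split; last exact: ip.
have [a ea] := unit_scalar (p j >>> i j).
have nza : a != 0 by apply: contraNneq nz => a0; rewrite ea a0 scale0r.
have pa : p j = a *: p j.
  by rewrite -[LHS]comp_idr -(ip j) comp_assoc ea compZl comp_idl.
have : a *: (p j >>> i j) = a *: idm one by rewrite -compZl -pa ea.
by move/(congr1 (fun s => a^-1 *: s)); rewrite !scalerA mulVf // !scale1r.
Qed.

Lemma schur_to_unit S (f : hom S one) : simple_obj S -> f != 0 ->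
  exists g : hom one S, g >>> f = idm one.
Proof.
move=> simS nzf; have [U [i [simU [p [ip pi]]]]] := unit_iso_simple.
have nzfi : f >>> i != 0.
  by apply: contraNneq nzf => e; rewrite -(comp_idr f) -ip comp_assoc e comp0l.
have [g [_ gfi]] := schur (fusion_semisimple C).1 simS simU nzfi.
exists (i >>> g); apply: (iso_cancelr ip).
by rewrite -!comp_assoc gfi comp_idr comp_idl.
Qed.

Lemma schur_from_unit S (f : hom one S) : simple_obj S -> f != 0 ->
  exists g : hom S one, g >>> f = idm S.
Proof.
move=> simS nzf; have [U [i [simU [p [ip pi]]]]] := unit_iso_simple.
have nzpf : p >>> f != 0.
  by apply: contraNneq nzf => e; rewrite -(comp_idl f) -ip -comp_assoc e comp0r.
have [g [_ gpf]] := schur (fusion_semisimple C).1 simU simS nzpf.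
by exists (g >>> p); rewrite -comp_assoc.
Qed.

(** The composition pairing of [Hom(1, Z)] and [Hom(Z, 1)] is nondegenerate: a
    nonzero [d : Z -> 1] is nonzero on some simple summand, and Schur's lemma
    splits it there. *)
Lemma from_unit_inj Z (g g' : hom Z one) :
  (forall h : hom one Z, h >>> g = h >>> g') -> g = g'.
Proof.
move=> e; apply/eqP; rewrite -subr_eq0; set d := g - g'.
have d0 (h : hom one Z) : h >>> d = 0.
  by rewrite /d -scaleN1r addrC compPr e scaleN1r addNr.
have [_ /(_ Z) [n [S [simS [i [p [_ _ id_sum]]]]]]] := fusion_semisimple C.
rewrite -(comp_idl d) -id_sum comp_suml; apply/eqP/big1 => j _.
rewrite -comp_assoc; have [->|nz] := eqVneq (i j >>> d) 0; first exact: comp0r.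
have [h hid] := schur_to_unit (simS j) nz.
by case/eqP: unit_neq0; rewrite -hid comp_assoc d0.
Qed.

(** Linear forms are taken with values in [End(1)], which is [k]. *)
Definition lin_form (V : vectType k) (phi : V -> hom one one) : Prop :=
  forall a u v, phi (a *: u + v) = a *: phi u + phi v.

(** On a simple summand [S j] not isomorphic to [1] the form vanishes; on one
    isomorphic to [1], the space [Hom(1, S j)] is a line and the value of the form
    on a generator [m] determines the map. *)
Lemma from_unit_represent Z (phi : hom one Z -> hom one one) :
  lin_form phi -> exists g : hom Z one, forall h, h >>> g = phi h.
Proof.
move=> phi_lin.
have phiD u v : phi (u + v) = phi u + phi v by have := phi_lin 1 u v; rewrite !scale1r.
have phi0 : phi 0 = 0 by apply: (addIr (phi 0)); rewrite -phiD !add0r.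
have phiZ a u : phi (a *: u) = a *: phi u.
  by have := phi_lin a u 0; rewrite phi0 !addr0.
have [_ /(_ Z) [n [S [simS [i [p [_ _ id_sum]]]]]]] := fusion_semisimple C.
have [j|g gP] := @fin_all_exists _ (fun j => hom (S j) one)
    (fun j (g : hom (S j) one) => forall h : hom one (S j), h >>> g = phi (h >>> i j)).
  have [m_dim|] := eqVneq (dim (hom one (S j))) 0%N.
    exists 0 => h; suff -> : h = 0 by rewrite !comp0l phi0.
    have : h \in (fullv : {vspace hom one (S j)}) by exact: memvf.
    by have /eqP := dimvf (hom one (S j)); rewrite m_dim dimv_eq0 => /eqP ->;
      rewrite memv0 => /eqP.
  rewrite -dimvf dimv_eq0 => nz; have := vpick0 (fullv : {vspace hom one (S j)}).
  set m := vpick _; rewrite (negPf nz) => /negbT nzm.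
  have [m' m'm] := schur_from_unit (simS j) nzm.
  exists (m' >>> phi (m >>> i j)) => h.
  have [a ea] := unit_scalar (h >>> m').
  rewrite comp_assoc ea compZl comp_idl -phiZ; congr phi.
  by rewrite -(comp_idr h) -m'm comp_assoc ea !compZl comp_idl.
exists (\sum_(j < n) (p j >>> g j)) => h.
rewrite comp_sumr -[in RHS](comp_idr h) -id_sum comp_sumr.
rewrite (big_morph phi phiD phi0); apply: eq_bigr => j _.
by rewrite comp_assoc gP -comp_assoc.
Qed.

End UnitPairing.

(** * The double dual as a Serre functor *)

Section Serre.
Variables (k : fieldType) (C : fusion_category k).
Implicit Types A B X Y Z : C.
Notation one := (@unit_obj k C).
Notation rtrace A f := (rloop (coev A) f (ev (dual A))).
Notation ltrace A f := (lloop (coev (dual A)) f (ev A)).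

(** Bending turns [rtrace A (p >>> r)] into the pairing of a map
    [1 -> B ⊗ A^*] with a map [B ⊗ A^* -> 1]. *)
Lemma rtrace_inj A B (r r' : hom B (dual (dual A))) :
  (forall p : hom A B, rtrace A (p >>> r) = rtrace A (p >>> r')) -> r = r'.
Proof.
move=> e.
have rK (s : hom B (dual (dual A))) :
    cobend (s ▷ dual A >>> ev (dual A)) (coev (dual A)) = s.
  by rewrite cobend_precomp ev_zagzig comp_idr.
rewrite -(rK r) -(rK r'); congr cobend; apply: from_unit_inj => h.
have := e (bend h (ev A)); rewrite (rloop_comp _ _ r) (rloop_comp _ _ r') /rloop.
by rewrite !coev_bend ?ev_zagzig.
Qed.

Lemma rtrace_represent A B (phi : hom A B -> hom one one) : lin_form phi ->
  exists r : hom B (dual (dual A)), forall p, rtrace A (p >>> r) = phi p.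
Proof.
move=> phi_lin.
have [|g gP] := @from_unit_represent _ _ (B ⊗ dual A) (fun h => phi (bend h (ev A))).
  by move=> a u v; rewrite /bend tensmPl compPr !compPl phi_lin.
exists (cobend g (coev (dual A))) => p.
rewrite /rloop rwhisker_comp -!comp_assoc cobend_ev; last exact: ev_zigzag.
by rewrite comp_assoc gP bend_postcomp ev_zigzag comp_idl.
Qed.

(** Bending turns [ltrace X (p >>> q)] into the pairing of a map
    [1 -> X^* ⊗ Z] with a map [X^* ⊗ Z -> 1]. *)
Lemma ltrace_inj X Z (q q' : hom Z X) :
  (forall p : hom (dual (dual X)) Z, ltrace X (p >>> q) = ltrace X (p >>> q')) -> q = q'.
Proof.
move=> e.
have qK (s : hom Z X) : bend (coev X) (dual X ◁ s >>> ev X) = s.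
  by rewrite bend_precomp ev_zigzag comp_idr.
rewrite -(qK q) -(qK q'); congr bend; apply: from_unit_inj => h.
have := e (cobend (ev (dual X)) h).
rewrite /lloop (lwhisker_comp _ _ q) (lwhisker_comp _ _ q') !comp_assoc.
by rewrite !coev_cobend //; exact: ev_zigzag.
Qed.

Lemma ltrace_represent X Z (phi : hom (dual (dual X)) Z -> hom one one) : lin_form phi ->
  exists q : hom Z X, forall p, ltrace X (p >>> q) = phi p.
Proof.
move=> phi_lin.
have [|g gP] := @from_unit_represent _ _ (dual X ⊗ Z) (fun h => phi (cobend (ev (dual X)) h)).
  by move=> a u v; rewrite /cobend tensmPr compPr !compPl phi_lin.
exists (bend (coev X) g) => p.
rewrite /lloop lwhisker_comp -!comp_assoc bend_ev ?ev_zagzig //.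
by rewrite comp_assoc gP cobend_postcomp ev_zagzig comp_idl.
Qed.

Lemma serre_ex X : exists g : hom X (dual (dual (dual (dual X)))),
  forall q : hom (dual (dual X)) X, rtrace (dual (dual X)) (q >>> g) = ltrace X q.
Proof.
apply: rtrace_represent => a u v.
by rewrite /lloop tensmPr compPr compPl.
Qed.

Definition serre X : hom X (dual (dual (dual (dual X)))) :=
  proj1_sig (constructive_indefinite_description _ (serre_ex X)).

Lemma serreP X (q : hom (dual (dual X)) X) :
  rtrace (dual (dual X)) (q >>> serre X) = ltrace X q.
Proof. exact: (proj2_sig (constructive_indefinite_description _ (serre_ex X))). Qed.

(** Post-composition with [serre X] is injective by nondegeneracy of the left
    trace, and a preimage [q] of the identity exists because the left trace
    represents the form [rtrace X^**]. *)
Lemma serre_iso X : is_iso (serre X).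
Proof.
have inj Z (h h' : hom Z X) : h >>> serre X = h' >>> serre X -> h = h'.
  move=> e; apply: ltrace_inj => p; rewrite -!serreP -!comp_assoc e //.
have [|q qP] := @ltrace_represent X (dual (dual (dual (dual X))))
    (fun p => rtrace (dual (dual X)) p).
  by move=> a u v; rewrite /rloop tensmPl compPr compPl.
have qK : q >>> serre X = idm _.
  by apply: rtrace_inj => p; rewrite comp_assoc serreP qP comp_idr.
exists q; split=> //; apply: inj.
by rewrite -comp_assoc qK comp_idr comp_idl.
Qed.

Lemma serre_nat X Y (f : hom X Y) :
  f >>> serre Y = serre X >>> dual_map (dual_map (dual_map (dual_map f))).
Proof.
apply: rtrace_inj => s; rewrite (comp_assoc s f) serreP (comp_assoc s (serre X)).
by rewrite -rloop_cyclic (comp_assoc _ s) serreP lloop_cyclic.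
Qed.

Lemma ftens_compareE X Y :
  ftens (double_dual C) X Y
  = cobend (ev_tens (dual Y) (dual X)) (coev (dual Y ⊗ dual X))
    >>> dual_map (cobend (ev (X ⊗ Y)) (coev_tens X Y)).
Proof. by []. Qed.

Lemma funit_compareE :
  funit (double_dual C)
  = cobend (lunit one) (coev one) >>> dual_map (cobend (ev one) (lunitV one)).
Proof. by []. Qed.

Lemma serre_tens X Y :
  serre (X ⊗ Y) = serre X ⊠ serre Y >>> ftens (quadruple_dual C) X Y.
Proof.
apply: rtrace_inj => q.
rewrite serreP (lloop_compare _ (tens_zigzag X Y) (tens_zigzag (dual Y) (dual X))) -ftens_compareE.
rewrite lloop_tens.
have -> : ftens (quadruple_dual C) X Y
  = ftens (double_dual C) (dual (dual X)) (dual (dual Y))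
    >>> dual_map (dual_map (ftens (double_dual C) X Y)) by [].
set J := ftens (double_dual C) X Y.
rewrite (comp_assoc (serre X ⊠ _)) (comp_assoc q) -rloop_cyclic.
rewrite (comp_assoc q) (comp_assoc J) ftens_compareE rloop_compare (comp_assoc J).
set r := J >>> q.
(* The first use of [serreP] moves the X loop from the right to the left; after
   the swap, the second one does the same to the Y loop. *)
by rewrite rloop_tens rclose_postcomp serreP loop_swap -rloop_comp serreP.
Qed.

Lemma unit_zigzag : zigzag (lunit one) (lunitV one).
Proof.
by rewrite /zigzag /bend -!comp_assoc (comp_assoc (assoc _ _ _)) triangle -lunit_unit
  (comp_assoc (lunitV one ▷ one)) (rwhiskerK _ (lunitVK _)) comp_idl lunitVK.
Qed.

(** Both traces of an endomorphism of [1], drawn with [1] as its own dual, are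
    that endomorphism. *)
Lemma serre_unit : serre one = funit (quadruple_dual C).
Proof.
apply: rtrace_inj => q.
have -> : funit (quadruple_dual C)
  = funit (double_dual C) >>> dual_map (dual_map (funit (double_dual C))) by [].
rewrite serreP (lloop_compare _ unit_zigzag unit_zigzag) -funit_compareE.
rewrite (comp_assoc q) -rloop_cyclic (comp_assoc _ q).
set J := funit (double_dual C); rewrite {2}/J funit_compareE rloop_compare.
set f := J >>> q; rewrite /lloop /rloop -!comp_assoc lunit_nat.
by rewrite lunit_unit runit_nat.
Qed.

End Serre.

Theorem theorem2p6 (k : closedFieldType) (char0 : [pchar k]%R =i pred0)
    (C : fusion_category k) :
  tensor_isomorphic (id_tensor_functor C) (quadruple_dual C).
Proof.
exists (@serre k C); split => /=.
- exact: serre_iso.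
- exact: serre_nat.
- by move=> X Y; rewrite comp_idl serre_tens.
- by rewrite comp_idl serre_unit.
Qed.
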